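(* Let $G$ be a polycyclic-by-finite group and let $S=\bigoplus_{g\in G}S_g$ be an epsilon-strongly $G$-graded ring with principal component $R=S_e$. Then $S$ is left noetherian if and only if $R$ is left noetherian, and $S$ is right noetherian if and only if $R$ is right noetherian.
   Context: All rings are associative with multiplicative identity $1\neq 0$. A ring $S$ is $G$-graded if $S=\bigoplus_{g\in G}S_g$ for additive subgroups $S_g$ with $S_gS_h\subseteq S_{gh}$ for all $g,h\in G$; $S_e$ ($e$ the neutral element) is the principal component. $S$ is epsilon-strongly $G$-graded if (a) $S_gS_{g^{-1}}S_g=S_g$ for all $g\in G$, and (b) for each $g\in G$ the ideal $S_gS_{g^{-1}}$ of $S_e$ has a multiplicative identity (is a unital ideal). A group is polycyclic-by-finite if it has a subnormal series $1=G_0\lhd G_1\lhd\cdots\lhd G_n\lhd G_{n+1}=G$ with $G/G_n$ finite and each $G_{i+1}/G_i$ ($0\le i\le n-1$) cyclic. *)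

(* Defs.v *)
From HB Require Import structures.
From mathcomp Require Import all_boot all_algebra.

Set Implicit Arguments.
Unset Strict Implicit.
Unset Printing Implicit Defensive.

Import GRing.Theory.
Local Open Scope ring_scope.

Section GroupDefs.
Variable G : groupType.

Definition gsubgroup (H : G -> Prop) : Prop :=
  [/\ H 1%g,
      (forall x y, H x -> H y -> H (x * y)%g) &
      (forall x, H x -> H (x^-1)%g)].

Definition gnormal_in (H K : G -> Prop) : Prop :=
  [/\ gsubgroup H, gsubgroup K,
      (forall x, H x -> K x) &
      (forall h k, H h -> K k -> H (k^-1 * h * k)%g)].

(* for H <| K : the quotient K/H is cyclic, i.e. K = U_{m in Z} a^m H *)
Definition cyclic_quotient (K H : G -> Prop) : Prop :=
  exists2 a, K a &
    forall x, K x -> exists n : nat, exists2 h, H h &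
      (x = (a ^+ n) * h \/ x = (a ^- n) * h)%g.

Definition finite_index (H : G -> Prop) : Prop :=
  exists s : seq G, forall x, exists2 t, t \in s & H (t^-1 * x)%g.

Definition polycyclic_by_finite : Prop :=
  exists (n : nat) (Gs : nat -> G -> Prop),
    [/\ (forall x, Gs 0%N x <-> x = 1%g),
        (forall i, (i < n)%N ->
           gnormal_in (Gs i) (Gs i.+1) /\ cyclic_quotient (Gs i.+1) (Gs i)),
        gnormal_in (Gs n) (fun _ => True) &
        finite_index (Gs n)].

End GroupDefs.

Section RingDefs.
Variable S : nzRingType.

Definition add_subgroup (A : S -> Prop) : Prop :=
  A 0 /\ (forall x y, A x -> A y -> A (x - y)).

Definition prodset (A B : S -> Prop) : S -> Prop :=
  fun z => exists l : seq (S * S),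
    (forall p, p \in l -> A p.1 /\ B p.2) /\ z = \sum_(p <- l) p.1 * p.2.

Definition graded_ring (G : groupType) (Sg : G -> S -> Prop) : Prop :=
  [/\ (forall g, add_subgroup (Sg g)),
      (forall s, exists gs : seq G, exists xs : seq S,
          [/\ size xs = size gs,
              (forall i, (i < size gs)%N -> Sg (nth 1%g gs i) (nth 0 xs i)) &
              s = \sum_(x <- xs) x]),
      (forall (gs : seq G) (xs : seq S),
          uniq gs -> size xs = size gs ->
          (forall i, (i < size gs)%N -> Sg (nth 1%g gs i) (nth 0 xs i)) ->
          \sum_(x <- xs) x = 0 ->
          forall i, (i < size xs)%N -> nth 0 xs i = 0) &
      (forall g h x y, Sg g x -> Sg h y -> Sg (g * h)%g (x * y))].

Definition has_mult_identity (I : S -> Prop) : Prop :=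
  exists2 e, I e & forall x, I x -> e * x = x /\ x * e = x.

Definition epsilon_strongly_graded (G : groupType) (Sg : G -> S -> Prop) : Prop :=
  [/\ graded_ring Sg,
      (forall g x, prodset (prodset (Sg g) (Sg (g^-1)%g)) (Sg g) x <-> Sg g x) &
      (forall g, has_mult_identity (prodset (Sg g) (Sg (g^-1)%g)))].

(* Left / right ideals of the subring R of S (R given as a subset of S;
   for R = S take the full predicate). *)
Definition left_ideal_in (R I : S -> Prop) : Prop :=
  [/\ add_subgroup I, (forall x, I x -> R x) &
      (forall r x, R r -> I x -> I (r * x))].

Definition right_ideal_in (R I : S -> Prop) : Prop :=
  [/\ add_subgroup I, (forall x, I x -> R x) &
      (forall r x, R r -> I x -> I (x * r))].

Definition acc_chains (P : (S -> Prop) -> Prop) : Prop :=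
  forall I : nat -> S -> Prop,
    (forall n, P (I n)) ->
    (forall n x, I n x -> I n.+1 x) ->
    exists N, forall m, (N <= m)%N -> forall x, I m x <-> I N x.

Definition left_noetherian_in (R : S -> Prop) : Prop :=
  acc_chains (left_ideal_in R).
Definition right_noetherian_in (R : S -> Prop) : Prop :=
  acc_chains (right_ideal_in R).

Definition left_noetherian : Prop := left_noetherian_in (fun _ => True).
Definition right_noetherian : Prop := right_noetherian_in (fun _ => True).

End RingDefs.

(* Main.v *)
Require Import Defs.
From HB Require Import structures.
From mathcomp Require Import all_boot all_algebra.

(** Write [S_P] for the sum of the components [S_g] with [g] in [P].  Since
    [S_g S_{g^-1}] contains a left identity of [S_g], every [y] in [S_P] is a
    sum of elements [u v y] with [u] in [S_g], [v] in [S_{g^-1}], [g] in [P].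

    Let [H] be normal in [K] with [S_H] left noetherian.  For a left ideal [J]
    of [S_K] and a set [Q] with [HQ = Q], let [D_Q(J)] be the left ideal of
    [S_H] of all [y] such that [y + w] is in [J] for some [w] in [S_Q].  If
    [D_Q(J') <= D_Q(J)] and [y + w] is in [J'] with [y] in [S_{cH}] and [w] in
    [S_{cQ}], then [J] contains an element of [y + S_{cQ}]: multiply by
    [S_{(ch)^-1}], pass from [J'] to [J], and multiply back by [S_{ch}].  This
    is Hilbert's leading-coefficient argument, and by translation the leading
    coefficients in [S_H] alone suffice.  If [K/H] is generated by [aH], take
    [Q = {a^-i h : 1 <= i <= p}]; as [D_Q(J)] increases with both [J] and [p],
    an ascending chain of [J]'s stabilises uniformly in [p].  If [H] has finite
    index, remove the finitely many cosets one at a time.  Directness of the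
    grading is needed only to descend from [S] to [S_e], where
    [S I] meets [S_e] in [I] for every left ideal [I] of [S_e]. *)

Set Implicit Arguments.
Unset Strict Implicit.
Unset Printing Implicit Defensive.

Import GRing.Theory.
Local Open Scope ring_scope.

(** * Additive subgroups of a ring *)

Section AddSubgroup.
Variables (S : nzRingType) (A : S -> Prop).
Hypothesis hA : add_subgroup A.

Lemma add_subgroup0 : A 0. Proof. by case: hA. Qed.

Lemma add_subgroupB x y : A x -> A y -> A (x - y).
Proof. by case: hA => _; apply. Qed.

Lemma add_subgroupN x : A x -> A (- x).
Proof. by move=> Ax; rewrite -sub0r; apply: add_subgroupB (add_subgroup0) Ax. Qed.

Lemma add_subgroupD x y : A x -> A y -> A (x + y).
Proof. by move=> Ax Ay; rewrite -[y]opprK; apply/add_subgroupB/add_subgroupN. Qed.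

Lemma add_subgroup_sum (I : eqType) (r : seq I) (P : pred I) (F : I -> S) :
  (forall i, i \in r -> P i -> A (F i)) -> A (\sum_(i <- r | P i) F i).
Proof.
move=> hF; rewrite big_seq_cond; apply: big_ind => [||i /andP[]].
- exact: add_subgroup0.
- exact: add_subgroupD.
- exact: hF.
Qed.

End AddSubgroup.

(** * Ascending chain conditions *)

Section Chains.
Variable S : nzRingType.

Lemma chain_le (I : nat -> S -> Prop) :
  (forall n x, I n x -> I n.+1 x) ->
  forall m n x, (m <= n)%N -> I m x -> I n x.
Proof.
move=> hI m n x /subnK <-; elim: (n - m)%N => [|k IHk] //= Im.
by rewrite addSn; apply/hI/IHk.
Qed.

Lemma acc_chains_ext (P Q : (S -> Prop) -> Prop) :
  (forall I, P I <-> Q I) -> acc_chains P -> acc_chains Q.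
Proof. by move=> PQ accP I QI; apply: accP => n; apply/PQ. Qed.

Lemma left_noetherian_in_ext (R R' : S -> Prop) :
  (forall x, R x <-> R' x) -> left_noetherian_in R -> left_noetherian_in R'.
Proof.
move=> RR'; apply: acc_chains_ext => I; split=> -[hI sI mI]; split=> //.
- by move=> x /sI/RR'.
- by move=> r x /RR'; apply: mI.
- by move=> x /sI/RR'.
- by move=> r x /RR'; apply: mI.
Qed.

(* Beyond the index N where the diagonal stabilises nothing moves, and there
   are only finitely many p below N. *)
Lemma acc_chains2 (P : (S -> Prop) -> Prop) (I : nat -> nat -> S -> Prop) :
  acc_chains P -> (forall p n, P (I p n)) ->
  (forall p n x, I p n x -> I p n.+1 x) ->
  (forall p n x, I p n x -> I p.+1 n x) ->
  exists N, forall p m x, (N <= m)%N -> I p m x -> I p N x.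
Proof.
move=> accP PI hn hp.
have le_n p := chain_le (hn p).
have le_p p q n x : (p <= q)%N -> I p n x -> I q n x.
  by apply: (@chain_le (fun p => I p n)) => k y; apply: hp.
have [N hN] : exists N, forall m, (N <= m)%N -> forall x, I m m x <-> I N N x.
  by apply: (accP (fun n => I n n)) => // n x; move/hn/hp.
have [M hM] : exists M, forall p m x,
    (p < N)%N -> (M <= m)%N -> I p m x -> I p M x.
  elim: (N) => [|k [M hM]]; first by exists 0%N.
  have [M' hM'] := accP (I k) (PI k) (hn k).
  exists (maxn M M') => p m x; rewrite ltnS leq_eqVlt geq_max.
  case/orP=> [/eqP->|lt_pk] /andP[leM leM'] Ix.
  - by apply: le_n (leq_maxr _ _) _; apply/(hM' m).
  - by apply: le_n (leq_maxl _ _) _; apply: hM Ix.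
exists (maxn M N) => p m x; rewrite geq_max => /andP[leMm leNm] Ix.
have [lt_pN|le_Np] := ltnP p N.
- by apply: le_n (leq_maxl _ _) _; apply: hM Ix.
- apply: (le_n _ N _ _ (leq_maxr _ _)); apply: (le_p N) => //.
  apply/(hN (maxn p m)); first by rewrite leq_max le_Np.
  apply: (le_n _ m); first apply: leq_maxr.
  by apply: (le_p p) => //; apply: leq_maxl.
Qed.

End Chains.

(** * Sums of graded components *)

Section Graded.
Variables (G : groupType) (S : nzRingType) (Sg : G -> S -> Prop).
Hypothesis Sg_add : forall g, add_subgroup (Sg g).
Hypothesis Sg_mul :
  forall g h x y, Sg g x -> Sg h y -> Sg (g * h)%g (x * y).

(** This is S_P, made inductive so that proofs peel off one homogeneous term at a time; degrees may
    repeat and no decomposition is chosen. *)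
Inductive gspan (P : G -> Prop) : S -> Prop :=
| gspan0 : gspan P 0
| gspanS g x y : P g -> Sg g x -> gspan P y -> gspan P (x + y).

Lemma gspan_comp (P : G -> Prop) g x : P g -> Sg g x -> gspan P x.
Proof. by move=> Pg Sx; rewrite -[x]addr0; apply: gspanS Pg Sx (gspan0 _). Qed.

Lemma gspan_sub (P Q : G -> Prop) :
  (forall g, P g -> Q g) -> forall x, gspan P x -> gspan Q x.
Proof.
move=> PQ x; elim=> [|g y z Pg Sy _ Qz]; first exact: gspan0.
exact: gspanS (PQ _ Pg) Sy Qz.
Qed.

Lemma gspanD P x y : gspan P x -> gspan P y -> gspan P (x + y).
Proof.
move=> Px Py; elim: Px => [|g z w Pg Sz _ IH]; first by rewrite add0r.
by rewrite -addrA; apply: gspanS Pg Sz IH.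
Qed.

Lemma gspan_add P : add_subgroup (gspan P).
Proof.
split=> [|x y Px Py]; first exact: gspan0.
apply: gspanD Px _; elim: Py => [|g z w Pg Sz _ IH].
  by rewrite oppr0; apply: gspan0.
by rewrite opprD; apply: gspanS Pg _ IH; apply: (add_subgroupN (Sg_add g)).
Qed.

Lemma gspanM (P Q V : G -> Prop) :
  (forall g h, P g -> Q h -> V (g * h)%g) ->
  forall x y, gspan P x -> gspan Q y -> gspan V (x * y).
Proof.
move=> PQV x y Px Qy; elim: Px => [|g u x' Pg Su _ IHx].
  by rewrite mul0r; apply: gspan0.
rewrite mulrDl; apply: gspanD IHx.
elim: Qy => [|h v y' Qh Sv _ IHy]; first by rewrite mulr0; apply: gspan0.
by rewrite mulrDr; apply: gspanS (PQV _ _ Pg Qh) (Sg_mul Su Sv) IHy.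
Qed.

Lemma gspan_split (P Q V : G -> Prop) : (forall g, P g -> Q g \/ V g) ->
  forall x, gspan P x -> exists y w, [/\ gspan Q y, gspan V w & x = y + w].
Proof.
move=> PQV x; elim=> [|g u x' Pg Su _ [y [w [Qy Vw ->]]]].
  by exists 0, 0; rewrite addr0; split=> //; apply: gspan0.
case: (PQV g Pg) => [Qg|Vg].
- by exists (u + y), w; rewrite addrA; split=> //; apply: gspanS Qg Su Qy.
- by exists y, (u + w); rewrite addrCA; split=> //; apply: gspanS Vg Su Vw.
Qed.

Lemma gspan1 x : gspan (fun g => g = 1%g) x <-> Sg 1%g x.
Proof.
split=> [|Sx]; last exact: (gspan_comp (erefl _) Sx).
elim=> [|_ y z -> Sy _ Sz]; first exact: (add_subgroup0 (Sg_add _)).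
exact: (add_subgroupD (Sg_add _)).
Qed.

(** * Reduction by local units *)

Section LocalUnits.
Hypothesis Sg_unit : forall g, exists l : seq (S * S),
  (forall p, p \in l -> Sg g p.1 /\ Sg (g^-1)%g p.2) /\
  forall x, Sg g x -> (\sum_(p <- l) p.1 * p.2) * x = x.

(* The multiplier r makes the induction work: removing the g-component of r x
   replaces r by r - e r, where e is a left identity of S_g in S_g S_{g^-1}. *)
Lemma gspan_local_unit (P : G -> Prop) x : gspan P x ->
  forall A : S -> Prop, add_subgroup A ->
  (forall g u v, P g -> Sg g u -> Sg (g^-1)%g v -> A (u * v * x)) -> A x.
Proof.
move=> Px A hA; rewrite -[x]mul1r.
have: forall g y, Sg g y -> Sg g (1 * y) by move=> g y; rewrite mul1r.
move: 1; elim: Px => [|g y w Pg Sy _ IH] r hr hx.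
  by rewrite mulr0; apply: add_subgroup0.
have [l [hl el]] := Sg_unit g; set e := \sum_(p <- l) _ in el.
have Se z h : Sg h z -> Sg h (e * z).
  move=> Sz; rewrite mulr_suml; apply: (add_subgroup_sum (Sg_add h)) => p lp _.
  have [Sp1 Sp2] := hl p lp.
  by rewrite -mulrA -[h](mulVKg g); apply/(Sg_mul Sp1)/Sg_mul.
have eE : r * (y + w) - e * (r * (y + w)) = (r - e * r) * w.
  by rewrite !mulrDr el; [rewrite opprD addrACA subrr add0r mulrBl mulrA | apply: hr].
(* The case [z = u * v] serves the induction hypothesis, and [z = 1] the term [e * (r * (y + w))]
   itself; 1 is not known here to lie in S_1. *)
have Ae z : Sg 1%g z \/ z = 1 -> A (z * (e * (r * (y + w)))).
  move=> hz; rewrite mulr_suml mulr_sumr.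
  apply: (add_subgroup_sum hA) => p lp _; have [Sp1 Sp2] := hl p lp.
  rewrite !mulrA -[_ * r * _]mulrA; apply: hx Pg _ Sp2.
  by case: hz => [Sz|->]; rewrite ?mul1r // -[g]mul1g; apply: Sg_mul.
rewrite -[r * _](subrK (e * (r * (y + w)))); apply: (add_subgroupD hA).
  rewrite eE; apply: IH => [h z Sz|h u v Ph Su Sv].
    rewrite mulrBl; apply: (add_subgroupB (Sg_add h)); first exact: hr.
    by rewrite -mulrA; apply/Se/hr.
  rewrite -eE mulrBr; apply: (add_subgroupB hA); first exact: hx Ph Su Sv.
  by apply: Ae; left; rewrite -(mulgV h); apply: Sg_mul.
by rewrite -[X in A X]mul1r; apply: Ae; right.
Qed.

(** * Leading ideals and extension steps *)

Section Step.
Variables H K : G -> Prop.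
Hypothesis nHK : gnormal_in H K.
Hypothesis noethH : left_noetherian_in (gspan H).

Let H1 : H 1%g. Proof. by case: nHK => -[]. Qed.
Let HM x y : H x -> H y -> H (x * y)%g.
Proof. by case: nHK => -[_ + _] _ _ _; apply. Qed.
Let HV x : H x -> H x^-1%g.
Proof. by case: nHK => -[_ _ +] _ _ _; apply. Qed.
Let KM x y : K x -> K y -> K (x * y)%g.
Proof. by case: nHK => _ [_ + _] _ _; apply. Qed.
Let KV x : K x -> K x^-1%g.
Proof. by case: nHK => _ [_ _ +] _ _; apply. Qed.
Let HK x : H x -> K x.
Proof. by case: nHK => _ _ + _; apply. Qed.
Let HJ h k : H h -> K k -> H (k^-1 * h * k)%g.
Proof. by case: nHK => _ _ _; apply. Qed.

(** This is D_Q(J), with [x] in the role of y + w. *)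
Definition lead_ideal (Q : G -> Prop) (J : S -> Prop) (y : S) : Prop :=
  gspan H y /\ exists2 x, J x & gspan Q (x - y).

Lemma lead_ideal_sub (Q Q' : G -> Prop) (J J' : S -> Prop) :
  (forall g, Q g -> Q' g) -> (forall x, J x -> J' x) ->
  forall y, lead_ideal Q J y -> lead_ideal Q' J' y.
Proof.
move=> QQ' JJ' y [Hy [x Jx Qx]]; split=> //.
by exists x; [apply: JJ' | apply: gspan_sub Qx].
Qed.

Lemma lead_ideal_left_ideal (Q : G -> Prop) (J : S -> Prop) :
  (forall h g, H h -> Q g -> Q (h * g)%g) ->
  left_ideal_in (gspan K) J -> left_ideal_in (gspan H) (lead_ideal Q J).
Proof.
move=> HQ [Jadd _ JM]; split; last 2 first.
- by move=> x [].
- move=> r y Hr [Hy [x Jx Qx]]; split; first exact: (gspanM HM).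
  exists (r * x); first by apply: JM => //; apply: gspan_sub Hr.
  by rewrite -mulrBr; apply: gspanM Hr Qx.
split.
  split; first exact: gspan0.
  by exists 0; [exact: add_subgroup0 | rewrite subrr; exact: gspan0].
move=> y y' [Hy [x Jx Qx]] [Hy' [x' Jx' Qx']].
split; first exact: (add_subgroupB (gspan_add _)).
exists (x - x'); first exact: (add_subgroupB Jadd).
rewrite opprD addrACA -opprD.
exact: (add_subgroupB (gspan_add _)).
Qed.

Lemma lead_cancel (Q : G -> Prop) (J J' : S -> Prop) c y w :
  (forall h g, H h -> Q g -> Q (h * g)%g) ->
  left_ideal_in (gspan K) J -> left_ideal_in (gspan K) J' ->
  (forall x, lead_ideal Q J' x -> lead_ideal Q J x) ->
  K c -> gspan (fun g => H (c^-1 * g)%g) y ->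
  gspan (fun g => Q (c^-1 * g)%g) w -> J' (y + w) ->
  exists2 z, J z & gspan (fun g => Q (c^-1 * g)%g) (z - y).
Proof.
move=> HQ [Jadd _ JM] [_ _ J'M] hD Kc Hy Qw J'yw.
pose cQ := gspan (fun g => Q (c^-1 * g)%g).
(* The property is additive, so [y] may be replaced by u v y with u in S_g, v in S_{g^-1}, g in cH.
   As g^-1 c is in H, v y lies in S_H and v w in S_Q. *)
apply: (gspan_local_unit Hy (A := fun y => exists2 z, J z & cQ (z - y))).
  split; first by exists 0; [exact: add_subgroup0 | rewrite subrr; exact: gspan0].
  move=> y1 y2 [z1 Jz1 Q1] [z2 Jz2 Q2]; exists (z1 - z2).
    exact: (add_subgroupB Jadd).
  rewrite opprD addrACA -opprD; exact: (add_subgroupB (gspan_add _)).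
move=> g u v Hg Su Sv.
have Kg : K g by rewrite -[g](mulVKg c); apply/KM/HK.
have SK h s : K h -> Sg h s -> gspan K s by apply: gspan_comp.
have [|_ [z Jz Qz]] := hD (v * y).
  split.
    apply: (gspanM (P := fun h => h = g^-1%g)) (gspan_comp (erefl _) Sv) Hy.
    move=> _ h -> Hh; rewrite -[h](mulVKg c) mulgA.
    by apply: HM => //; rewrite -[c]invgK -invgM; apply: HV.
  exists (v * (y + w)); first by apply: J'M => //; apply: SK Sv; apply: KV.
  rewrite mulrDr addrC addKr.
  apply: (gspanM (P := fun h => h = g^-1%g)) (gspan_comp (erefl _) Sv) Qw.
  move=> _ h -> Qh; rewrite -[h](mulVKg c) mulgA.
  by apply: HQ => //; rewrite -[c]invgK -invgM; apply: HV.
exists (u * z); first by apply: JM => //; apply: SK Su.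
rewrite -mulrA -mulrBr.
apply: (gspanM (P := fun h => h = g)) (gspan_comp (erefl _) Su) Qz.
by move=> _ h -> Qh; rewrite mulgA; apply: HQ.
Qed.

Lemma noetherian_cyclic_extension :
  cyclic_quotient K H -> left_noetherian_in (gspan K).
Proof.
case=> a Ka genK J Jid Jmono.
pose Q p g := exists i h, [/\ (0 < i <= p)%N, H h & g = (a ^- i * h)%g].
have KX i : K (a ^- i)%g.
  by apply: KV; elim: i => [|i IHi]; [rewrite expg0; apply: HK | rewrite expgS; apply: KM].
have HQ p h g : H h -> Q p g -> Q p (h * g)%g.
  move=> Hh [i [h' [ip Hh' ->]]].
  (* Normality moves [h] across: h a^-i = a^-i (a^i h a^-i). *)
  exists i, ((a ^- i)^-1 * h * a ^- i * h')%g; split=> //.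
    by apply: HM => //; apply: HJ.
  by rewrite !mulgA mulgV mul1g.
have QS p g : Q p g -> Q p.+1 g.
  move=> [i [h [/andP[i0 ip] Hh ->]]]; exists i, h; split=> //.
  by rewrite i0 leqW.
have [] := acc_chains2 (I := fun p n => lead_ideal (Q p) (J n)) noethH.
- by move=> p n; apply: lead_ideal_left_ideal => //; apply: HQ.
- by move=> p n; apply: lead_ideal_sub => // x; apply: Jmono.
- by move=> p n; apply: lead_ideal_sub => //; apply: QS.
move=> N hN; exists N => m leNm x; split; last exact: chain_le leNm.
have [JNadd _ _] := Jid N; have [Jmadd JmK _] := Jid m.
(* A window of cosets c a^-i H with 0 <= i <= p; its top coset cH carries the leading term. *)
pose win c p g := H (c^-1 * g)%g \/ Q p (c^-1 * g)%g.
have winE c p g :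
    win c p g <-> exists i h, [/\ (i <= p)%N, H h & g = (c * (a ^- i * h))%g].
  split=> [[Hg|[i [h [/andP[_ ip] Hh /(canRL (mulKg _))]]]]|].
  - by exists 0%N, (c^-1 * g)%g; rewrite expg0 invg1 mul1g mulVKg.
  - by rewrite invgK => gE; exists i, h.
  - case=> -[|i] [h [ip Hh ->]]; rewrite /win mulKg.
      by left; rewrite expg0 invg1 mul1g.
    by right; exists i.+1, h.
have main p : forall c y, K c -> gspan (win c p) y -> J m y -> J N y.
  elim: p => [|p IHp] c _ Kc /(gspan_split (fun g h => h))[y [w [Hy Qw ->]]] Jx.
  - have [z Jz Qz] := lead_cancel (@HQ 0%N) (Jid N) (Jid m)
      (fun t => @hN 0%N m t leNm) Kc Hy Qw Jx.
    (* For p = 0 no lower coset remains, which forces z = y and w = 0. *)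
    have Q0 t : gspan (fun g => Q 0%N (c^-1 * g)%g) t -> t = 0.
      by case=> // g ? ? [i [h [/andP[]]]]; case: i.
    by move/Q0/subr0_eq: Qz Jz => ->; rewrite (Q0 _ Qw) addr0.
  have [z Jz Qz] := lead_cancel (@HQ p.+1) (Jid N) (Jid m)
      (fun t => @hN p.+1 m t leNm) Kc Hy Qw Jx.
  have Jmz : J m z := chain_le Jmono leNm Jz.
  rewrite -[y + w](subrK z); apply: (add_subgroupD JNadd) => //.
  (* Cancelling the leading term leaves w - (z - y), supported on c a^-i H with 1 <= i <= p + 1,
     which is the window [win (c * a^-1) p]. *)
  apply: (IHp (c * a^-1)%g); first by apply/KM/KV.
    apply: (@gspan_sub (fun g => Q p.+1 (c^-1 * g)%g)).
      move=> g [[|i] [h [// ip Hh /(canRL (mulKg _)) gE]]].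
      apply/winE; exists i, h; split=> //.
      by rewrite gE invgK expgSr invgM !mulgA.
    rewrite addrAC -opprB addrC; apply: (add_subgroupB (gspan_add _)) => //.
  exact: (add_subgroupB Jmadd).
move=> Jx.
(* Finitely many degrees fit into one window, if its top is high enough. *)
have [n [p hx]] : exists n p, gspan (win (a ^+ n)%g p) x.
  elim: (JmK x Jx) => [|g u y Kg Su _ [n [p hy]]].
    by exists 0%N, 0%N; apply: gspan0.
  have [k [i0 [h0 [Hh0 gE]]]] : exists k i h, H h /\ g = (a ^+ k * (a ^- i * h))%g.
    have [k [h Hh [->|->]]] := genK g Kg.
    - by exists k, 0%N, h; rewrite expg0 invg1 mul1g.
    - by exists 0%N, k, h; rewrite expg0 mul1g.
  have shift d i j h :
      (a ^+ i * (a ^- j * h) = a ^+ (i + d) * (a ^- (j + d) * h))%g.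
    by rewrite !expgnDr invgM !mulgA mulgK.
  (* Raising the top from a^n to a^(n+k) lowers the old cosets to depth at most p + k and puts [g]
     at depth i0 + n; the sum bounds both. *)
  exists (n + k)%N, (p + k + (i0 + n))%N; apply: (gspanS (g := g)) => //.
  - apply/winE; exists (i0 + n)%N, h0; split=> //; first exact: leq_addl.
    by rewrite gE (shift n) addnC.
  - apply: gspan_sub hy => g' /winE [i [h [ip Hh ->]]]; apply/winE.
    exists (i + k)%N, h; split=> //.
    by apply: leq_trans (leq_addr _ _); rewrite leq_add2r.
apply: main hx Jx; rewrite -[(a ^+ n)%g]invgK; exact/KV.
Qed.

Lemma noetherian_finite_index : (forall x, K x) ->
  finite_index H -> left_noetherian_in (gspan K).
Proof.
move=> Kall [s hs] J Jid Jmono.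
(* Induction on a list of coset representatives that covers the support of the elements compared. *)
have claim (r : seq G) : exists N, forall m x, (N <= m)%N -> J m x ->
    gspan (fun g => exists2 t, t \in r & H (t^-1 * g)%g) x -> J N x.
  elim: r => [|t r [N hN]].
    exists 0%N => m x _ _ [|g ? ? []] //.
    by apply: add_subgroup0; case: (Jid 0%N).
  (* The shift by [t] makes tQ the union of the cosets over [r], with tH as leading coset. *)
  pose Q g := exists2 t', t' \in r & H (t'^-1 * (t * g))%g.
  have HQ h g : H h -> Q g -> Q (h * g)%g.
    move=> Hh [t' rt' Ht']; exists t' => //.
    have := HM (HJ Hh (Kall (t^-1 * t')%g)) Ht'.
    by rewrite invgM invgK !mulgA mulgK mulgVK.
  have [||N' hN'] := noethH (I := fun n => lead_ideal Q (J n)).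
  - by move=> n; apply: lead_ideal_left_ideal.
  - by move=> n; apply: lead_ideal_sub => // x; apply: Jmono.
  (* [N'] settles the leading coset, [N] the remainder after cancellation. *)
  exists (maxn N N') => m x; rewrite geq_max => /andP[leNm leN'm] Jx hx.
  set M := maxn N N'.
  have leMm : (M <= m)%N by rewrite geq_max leNm.
  have hx' : gspan (fun g => H (t^-1 * g)%g \/ Q (t^-1 * g)%g) x.
    apply: gspan_sub hx => g [t']; rewrite inE => /orP[/eqP->|rt'] Ht'; first by left.
    by right; exists t' => //; rewrite mulVKg.
  have [y [w [Hy Qw xE]]] := gspan_split (fun g h => h) hx'.
  have Jyw : J m (y + w) by rewrite -xE.
  have [|z Jz Qz] := lead_cancel HQ (Jid M) (Jid m) _ (Kall t) Hy Qw Jyw.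
    move=> u Lu; apply: (@lead_ideal_sub Q Q (J N')) => //.
      by move=> v; apply: chain_le (leq_maxr _ _).
    by apply/(hN' m).
  have [JMadd _ _] := Jid M; have [Jmadd _ _] := Jid m.
  rewrite -[x](subrK z); apply: (add_subgroupD JMadd) => //.
  apply: (chain_le Jmono (leq_maxl _ _)); apply: (hN m) => //.
    by apply: (add_subgroupB Jmadd) => //; exact: (chain_le Jmono leMm Jz).
  apply: (@gspan_sub (fun g => Q (t^-1 * g)%g)).
    by move=> g [t' rt']; rewrite mulVKg => Ht'; exists t'.
  rewrite xE addrAC -opprB; apply: (add_subgroupD (gspan_add _)) => //.
  exact: (add_subgroupN (gspan_add _)).
have [N hN] := claim s; exists N => m leNm x; split; last exact: chain_le leNm.
move=> Jx; apply: (hN m) => //; have [_ JK _] := Jid m.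
by apply: gspan_sub (JK _ Jx) => g _; apply: hs.
Qed.

End Step.

(** Cyclic extensions climb the series from S_{G_0} = S_1, and the finite quotient gives the last
    step. *)
Lemma left_noetherian_of_principal :
  polycyclic_by_finite G -> (forall x, gspan (fun _ => True) x) ->
  left_noetherian_in (Sg 1%g) -> left_noetherian S.
Proof.
move=> [n [Gs [Gs0 Gs_step Gs_norm Gs_fin]]] Sfull noethR.
have noeth i : (i <= n)%N -> left_noetherian_in (gspan (Gs i)).
  elim: i => [_|i IHi lt_in].
    apply: left_noetherian_in_ext noethR => x.
    split=> [/gspan1|] hx; first by apply: gspan_sub hx => g ->; apply/Gs0.
    by apply/gspan1; apply: gspan_sub hx => g /Gs0.
  have [nHK cKH] := Gs_step i lt_in.
  by apply: noetherian_cyclic_extension nHK _ cKH; apply/IHi/ltnW.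
have := noetherian_finite_index Gs_norm (noeth n (leqnn n)) (fun=> I) Gs_fin.
exact: left_noetherian_in_ext.
Qed.

End LocalUnits.

(** * Descent to the principal component *)

Section Direct.
Hypothesis Sg_direct : forall (gs : seq G) (xs : seq S),
  uniq gs -> size xs = size gs ->
  (forall i, (i < size gs)%N -> Sg (nth 1%g gs i) (nth 0 xs i)) ->
  \sum_(x <- xs) x = 0 -> forall i, (i < size xs)%N -> nth 0 xs i = 0.

(** Directness is stated for distinct degrees, while degrees may repeat in [l]; collecting equal
    degrees into [F] bridges the gap. *)
Lemma homogeneous_sum_eq0 (l : seq (G * S)) g :
  (forall p, p \in l -> Sg p.1 p.2) -> \sum_(p <- l) p.2 = 0 ->
  \sum_(p <- l | p.1 == g) p.2 = 0.
Proof.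
move=> hl sum0; pose gs := undup (map fst l).
pose F h := \sum_(p <- l | p.1 == h) p.2.
have SF h : Sg h (F h).
  by apply: (add_subgroup_sum (Sg_add h)) => p lp /eqP <-; apply: hl.
have sumF : \sum_(x <- map F gs) x = 0.
  rewrite big_map -[RHS]sum0 /F.
  under eq_bigr do rewrite big_mkcond /=.
  rewrite exchange_big /= [LHS]big_seq [RHS]big_seq; apply: eq_bigr => p lp.
  rewrite -big_mkcond /= (eq_bigl (pred1 p.1)); last by move=> h; rewrite eq_sym.
  by rewrite big_const_seq count_uniq_mem ?undup_uniq // mem_undup map_f //= addr0.
have [gsg|gsNg] := boolP (g \in gs).
  have lt_i : (index g gs < size gs)%N by rewrite index_mem.
  have := Sg_direct (undup_uniq _) (size_map F gs) _ sumF.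
  move=> /(_ _ (index g gs)); rewrite size_map (nth_map 1%g) // nth_index //.
  by apply=> // i lt_i'; rewrite (nth_map 1%g).
rewrite big_seq_cond big_pred0 // => p; apply/negbTE/negP=> /andP[lp /eqP pg].
by move: gsNg; rewrite mem_undup -pg map_f.
Qed.

Lemma principal_left_noetherian :
  (forall x, gspan (fun _ => True) x) ->
  left_noetherian S -> left_noetherian_in (Sg 1%g).
Proof.
move=> Sfull noethS I Iid Imono.
have [||N hN] := noethS (fun n => prodset (fun _ => True) (I n)).
- move=> n; have [Iadd _ _] := Iid n; split=> //.
    split; first by exists [::]; rewrite big_nil.
    move=> _ _ [l [hl ->]] [l' [hl' ->]].
    exists (l ++ [seq (- p.1, p.2) | p <- l']); split.
      by move=> p; rewrite mem_cat => /orP[/hl|/mapP[q /hl' [_ Iq] ->]].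
    rewrite big_cat big_map -sumrN; congr (_ + _).
    by apply: eq_bigr => p _; rewrite mulNr.
  move=> r _ _ [l [hl ->]]; exists [seq (r * p.1, p.2) | p <- l]; split.
    by move=> p /mapP[q /hl [_ Iq] ->].
  by rewrite big_map mulr_sumr; apply: eq_bigr => p _; rewrite mulrA.
- by move=> n x [l [hl ->]]; exists l; split=> // p /hl [_ /Imono].
exists N => m leNm x; split; last exact: chain_le leNm.
move=> Ix; have [_ IS _] := Iid m; have Sx := IS x Ix.
have [Iadd INS IM] := Iid N.
have [l [hl xE]] : prodset (fun _ => True) (I N) x.
  apply/(hN m leNm); exists [:: (1, x)]; rewrite big_seq1 mul1r; split=> //.
  by move=> p; rewrite inE => /eqP ->.
(* Split each coefficient into homogeneous terms u: since [I N] lies in S_1, u y has the degree of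
   u, and it stays in [I N] when that degree is 1. *)
have [k [hk1 hkI xk]] : exists k : seq (G * S),
    [/\ (forall p, p \in k -> Sg p.1 p.2),
        (forall p, p \in k -> p.1 = 1%g -> I N p.2) & x = \sum_(p <- k) p.2].
  rewrite {}xE; elim: l hl => [|[s y] l IHl] hl.
    by exists [::]; rewrite !big_nil.
  have [|k [hk1 hkI kE]] := IHl; first by move=> p lp; apply: hl; rewrite inE lp orbT.
  have [/= _ Iy] := hl (s, y) (mem_head _ _).
  rewrite big_cons /= kE; elim: (Sfull s) => [|g u s' _ Su _ [k' [h1 hI E]]].
    by rewrite mul0r add0r; exists k.
  exists ((g, u * y) :: k'); rewrite big_cons -E mulrDl addrA; split=> //.
    move=> p; rewrite inE => /orP[/eqP->|/h1] //=.
    by rewrite -[g]mulg1; apply: Sg_mul Su (INS _ Iy).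
  move=> p; rewrite inE => /orP[/eqP->|/hI] //= g1.
  by apply: IM => //; rewrite -g1.
(* Adjoining -x in degree 1 makes the sum vanish, so x equals the degree 1 part of [k]. *)
have := @homogeneous_sum_eq0 ((1%g, - x) :: k) 1%g.
rewrite !big_cons /= eqxx -xk addNr => /(_ _ erefl) h.
have {}h : - x + \sum_(p <- k | p.1 == 1%g) p.2 = 0.
  apply: h => p; rewrite inE => /orP[/eqP->|/hk1] //=.
  exact: (add_subgroupN (Sg_add _)).
have -> : x = \sum_(p <- k | p.1 == 1%g) p.2.
  by move/eqP: h; rewrite addrC subr_eq0 => /eqP.
by apply: (add_subgroup_sum Iadd) => p kp /eqP; apply: hkI.
Qed.

End Direct.

End Graded.

Lemma graded_gspan_full (G : groupType) (S : nzRingType) (Sg : G -> S -> Prop) :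
  graded_ring Sg -> forall x, gspan Sg (fun _ => True) x.
Proof.
case=> _ + _ _ x => /(_ x) [gs [xs [sz hS ->]]].
elim: xs gs sz hS => [|y xs IH] [|g gs] //= sz hS.
  by rewrite big_nil; apply: gspan0.
rewrite big_cons; apply: (gspanS (g := g)) => //; first exact: (hS 0%N).
by apply: (IH gs) => [|i]; [case: sz | apply: (hS i.+1)].
Qed.

(** * Epsilon-strong gradings, left and right *)

Section Main.
Variables (G : groupType) (S : nzRingType) (Sg : G -> S -> Prop).
Hypothesis pcf : polycyclic_by_finite G.
Hypothesis eps : epsilon_strongly_graded Sg.

Lemma epsilon_left_noetherian :
  left_noetherian S <-> left_noetherian_in (Sg 1%g).
Proof.
case: eps => grS triple unit_id; have full := graded_gspan_full grS.
case: grS => Sadd _ Sdir Smul; split.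
  exact: principal_left_noetherian.
apply: left_noetherian_of_principal => // g.
(* The identity of S_g S_{g^-1} fixes S_g on the left because S_g = S_g S_{g^-1} S_g. *)
have [_ [l [hl ->]] el] := unit_id g; exists l; split=> // x.
move/triple => [k [hk ->]]; rewrite mulr_sumr big_seq [RHS]big_seq.
by apply: eq_bigr => p /hk [/el [ep _] _]; rewrite mulrA ep.
Qed.

(* The converse ring is graded by g |-> S_{g^-1}. *)
Lemma epsilon_right_noetherian :
  right_noetherian S <-> right_noetherian_in (Sg 1%g).
Proof.
case: eps => grS triple unit_id; have full := graded_gspan_full grS.
case: grS => Sadd _ Sdir Smul.
pose Sc g : S^c -> Prop := Sg g^-1%g.
have Sc_add g : @add_subgroup S^c (Sc g) by apply: Sadd.
have Sc_mul g h (x y : S^c) : Sc g x -> Sc h y -> Sc (g * h)%g (x * y).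
  by rewrite /Sc invgM => Sx Sy; apply: Smul Sy Sx.
have Sc_full (x : S^c) : gspan Sc (fun _ => True) x.
  elim: (full x) => [|g u y _ Su _]; first exact: gspan0.
  by apply: (gspanS (g := g^-1%g)) => //; rewrite /Sc invgK.
have Sc1 : Sc 1%g = Sg 1%g by rewrite /Sc invg1.
(* Right ideals of [S] are left ideals of [S^c] by conversion. *)
change (@left_noetherian S^c <-> @left_noetherian_in S^c (Sg 1%g)).
rewrite -Sc1; split.
  apply: principal_left_noetherian => // gs xs ugs sz hS.
  apply: (Sdir (map (fun g => g^-1)%g gs)); rewrite ?size_map //.
    by rewrite map_inj_uniq //; apply: invg_inj.
  by move=> i lt_i; rewrite (nth_map 1%g) //; apply: hS.
apply: left_noetherian_of_principal => // g.
have [_ [l [hl ->]] el] := unit_id g.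
(* Swapping the pairs yields in [S^c] the identity of S_g S_{g^-1}, which in [S] fixes S_{g^-1} =
   S_{g^-1} S_g S_{g^-1} on the right. *)
exists [seq (p.2, p.1) | p <- l]; split.
  by move=> _ /mapP[p /hl[S1 S2] ->]; rewrite /Sc invgK.
move=> x Sx; rewrite big_map.
change (@GRing.mul S x (\sum_(p <- l) p.1 * p.2) = x).
move/triple: Sx; rewrite invgK => -[k [hk ->]].
rewrite mulr_suml big_seq [RHS]big_seq; apply: eq_bigr => p /hk [].
case=> [l' [hl' ->]] Sp2; rewrite !mulr_suml big_seq [RHS]big_seq.
apply: eq_bigr => q /hl' [Sq1 Sq2].
rewrite -!mulrA; congr (_ * _); rewrite mulrA; apply: (proj2 (el _ _)).
by exists [:: (q.2, p.2)]; rewrite big_seq1; split=> // r; rewrite inE => /eqP ->.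
Qed.

End Main.

Theorem theorem1p1 (G : groupType) (S : nzRingType) (Sg : G -> S -> Prop) :
  polycyclic_by_finite G ->
  epsilon_strongly_graded Sg ->
  (left_noetherian S <-> left_noetherian_in (Sg 1%g)) /\
  (right_noetherian S <-> right_noetherian_in (Sg 1%g)).
Proof.
move=> pcf eps; split.
- exact: epsilon_left_noetherian.
- exact: epsilon_right_noetherian.
Qed.
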